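(* Let $n=n_1\le n_2$ and $m$ be positive integers and let $\varepsilon\ge 0$. Let $\mathbf{P}$ be a property of matrices in $\mathbb{R}^{m\times n}$, let $\mathbf{Q}$ be a property of vectors in $\mathbb{R}^n$, let $\|\cdot\|_v$ be a norm on $\mathbb{R}^n$ with $\|x\|_v=\|\bar x\|_v$ for all $x$, let $\|\cdot\|_m$ be the corresponding unitarily invariant norm on $\mathbb{R}^{n_1\times n_2}$ given by $\|X\|_m=\|\Sigma(X)\|_v$, and let $h$ be a real-valued function on $\mathbb{R}^n\times[0,\infty)$. Then the following two implications hold. (1) Suppose that every matrix $A\in\mathbb{R}^{m\times n}$ satisfying $\mathbf{P}$ has the property: for every $x_0\in\mathbb{R}^n$, every $z\in\mathbb{R}^m$ with $\|z\|_2\le\varepsilon$, $y=Ax_0+z$, and every $x^*$ that is as good as $x_0$ with respect to $y$, one has $\|x^*-x_0\|_v\le h(\bar x_0,\varepsilon)$. Then every linear operator $\mathcal{A}:\mathbb{R}^{n_1\times n_2}\to\mathbb{R}^m$ satisfying the extension property $\mathbf{P}^e$ has the property: for every $X_0\in\mathbb{R}^{n_1\times n_2}$, every $z\in\mathbb{R}^m$ with $\|z\|_2\le\varepsilon$, $y=\mathcal{A}(X_0)+z$, and every $X^*$ that is as good as $X_0$ with respect to $y$, one has $\|X^*-X_0\|_m\le h(\Sigma(X_0),\varepsilon)$. (2) Suppose that for every matrix $A\in\mathbb{R}^{m\times n}$ satisfying $\mathbf{P}$, every $w$ in the null space of $A$ satisfies $\mathbf{Q}$. Then for every linear operator $\mathcal{A}:\mathbb{R}^{n_1\times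 n_2}\to\mathbb{R}^m$ satisfying the extension property $\mathbf{P}^e$, and every $W$ in the null space of $\mathcal{A}$, the vector $\Sigma(W)$ satisfies $\mathbf{Q}$.
   Context: For $x\in\mathbb{R}^n$, $\bar x$ is the vector obtained by sorting the absolute values of the entries of $x$ in decreasing order. For $X\in\mathbb{R}^{n_1\times n_2}$ with $n_1\le n_2$, $\Sigma(X)=(\sigma_1(X),\dots,\sigma_{n_1}(X))^T$ is the vector of singular values in decreasing order, and $\|X\|_\star=\sum_{i=1}^{n_1}\sigma_i(X)$ is the nuclear norm. As good as (vectors): given $A\in\mathbb{R}^{m\times n}$, $y\in\mathbb{R}^m$ and noise level $\varepsilon$, $x^*$ is as good as $x_0$ with respect to $y$ if $\|Ax^*-y\|_2\le\varepsilon$ and $\|x^*\|_1\le\|x_0\|_1$. As good as (matrices): given $\mathcal{A}$, $y$ and $\varepsilon$, $X^*$ is as good as $X_0$ with respect to $y$ if $\|\mathcal{A}(X^* )-y\|_2\le\varepsilon$ and $\|X^*\|_\star\le\|X_0\|_\star$. A unitary pair $(U,V)$ consists of $U\in\mathbb{R}^{n_1\times n_1}$, $V\in\mathbb{R}^{n_2\times n_1}$ with $U^TU=UU^T=V^TV=I$. The restriction of a linear operator $\mathcal{A}:\mathbb{R}^{n_1\times n_2}\to\mathbb{R}^m$ to $(U,V)$ is the linear map $\mathbb{R}^{n_1}\to\mathbb{R}^m$, $x\mapsto\mathcal{A}(U\,\mathrm{diag}(x)\,V^T)$, where $\mathrm{diag}(x)$ is the diagonal matrix with diagonal $x$; its matrix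 is denoted $A_{U,V}\in\mathbb{R}^{m\times n_1}$. Extension property: $\mathcal{A}$ satisfies $\mathbf{P}^e$ if $A_{U,V}$ satisfies $\mathbf{P}$ for every unitary pair $(U,V)$. *)

(* Defs.v *)
From mathcomp Require Import all_boot all_order all_algebra.
From mathcomp Require Import interval_inference reals polyrcf.

Set Implicit Arguments.
Unset Strict Implicit.
Unset Printing Implicit Defensive.

Import Order.TTheory GRing.Theory Num.Theory.

Local Open Scope ring_scope.

Definition l1norm (R : realType) (n : nat) (x : 'cV[R]_n) : R :=
  \sum_(i < n) `|x i 0|.

Definition l2norm (R : realType) (n : nat) (x : 'cV[R]_n) : R :=
  Num.sqrt (\sum_(i < n) x i 0 ^+ 2).

(* A predicate rather than the canonical norm structure on 'cV[R]_n, which is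
   fixed to the sup norm. Nonnegativity of v follows from the three axioms. *)
Record is_norm (R : realType) (n : nat) (v : 'cV[R]_n -> R) : Prop := IsNorm {
  is_norm_eq0 : forall x, v x = 0 -> x = 0;
  is_normZ : forall (a : R) x, v (a *: x) = `|a| * v x;
  is_normD : forall x y, v (x + y) <= v x + v y
}.

Definition sort_abs (R : realType) (n : nat) (x : 'cV[R]_n) : 'cV[R]_n :=
  \col_(i < n) nth 0 (sort >=%R [seq `|x j 0| | j <- enum 'I_n]) i.

(* Real eigenvalues with algebraic multiplicity, in decreasing order. For a
   symmetric matrix the characteristic polynomial splits over R, so this
   sequence has exactly n entries. *)
Definition eigenvalues (R : realType) (n : nat) (S : 'M[R]_n) : seq R :=
  let p := char_poly S in
  sort >=%R (flatten [seq nseq (mup a p) a | a <- rootsR p]).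

(* Sigma(X), meant for n1 <= n2: the square roots of the n1 eigenvalues of the
   n1 x n1 matrix X X^T. *)
Definition singular_values (R : realType) (n1 n2 : nat) (X : 'M[R]_(n1, n2)) :
    'cV[R]_n1 :=
  \col_(i < n1) Num.sqrt (nth 0 (eigenvalues (X *m X^T)) i).

Definition nuclear_norm (R : realType) (n1 n2 : nat) (X : 'M[R]_(n1, n2)) : R :=
  \sum_(i < n1) singular_values X i 0.

Definition induced_mnorm (R : realType) (n1 n2 : nat) (v : 'cV[R]_n1 -> R)
    (X : 'M[R]_(n1, n2)) : R :=
  v (singular_values X).

Definition as_good_vec (R : realType) (m n : nat) (A : 'M[R]_(m, n))
    (y : 'cV[R]_m) (eps : R) (xs x0 : 'cV[R]_n) : Prop :=
  l2norm (A *m xs - y) <= eps /\ l1norm xs <= l1norm x0.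

Definition as_good_mx (R : realType) (m n1 n2 : nat)
    (calA : {linear 'M[R]_(n1, n2) -> 'cV[R]_m})
    (y : 'cV[R]_m) (eps : R) (Xs X0 : 'M[R]_(n1, n2)) : Prop :=
  l2norm (calA Xs - y) <= eps /\ nuclear_norm Xs <= nuclear_norm X0.

Definition unitary_pair (R : realType) (n1 n2 : nat)
    (U : 'M[R]_n1) (V : 'M[R]_(n2, n1)) : Prop :=
  [/\ U^T *m U = 1%:M, U *m U^T = 1%:M & V^T *m V = 1%:M].

Definition restriction (R : realType) (m n1 n2 : nat)
    (calA : {linear 'M[R]_(n1, n2) -> 'cV[R]_m})
    (U : 'M[R]_n1) (V : 'M[R]_(n2, n1)) (x : 'cV[R]_n1) : 'cV[R]_m :=
  calA (U *m diag_mx x^T *m V^T).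

Definition restriction_mx (R : realType) (m n1 n2 : nat)
    (calA : {linear 'M[R]_(n1, n2) -> 'cV[R]_m})
    (U : 'M[R]_n1) (V : 'M[R]_(n2, n1)) : 'M[R]_(m, n1) :=
  \matrix_(i, j) restriction calA U V (delta_mx j 0) i 0.

Lemma restriction_mxE (R : realType) (m n1 n2 : nat)
    (calA : {linear 'M[R]_(n1, n2) -> 'cV[R]_m})
    (U : 'M[R]_n1) (V : 'M[R]_(n2, n1)) (x : 'cV[R]_n1) :
  restriction_mx calA U V *m x = restriction calA U V x.
Proof.
have Ex : x = \sum_j x j 0 *: delta_mx j 0.
  rewrite {1}[x]matrix_sum_delta; apply: eq_bigr => j _.
  by rewrite big_ord_recl big_ord0 addr0.
have -> : restriction calA U V x =
    \sum_j x j 0 *: restriction calA U V (delta_mx j 0).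
  rewrite {1}Ex /restriction !linear_sum mulmx_suml linear_sum.
  by apply: eq_bigr => j _; rewrite !linearZ /= -scalemxAl linearZ.
apply/colP => i; rewrite mxE summxE; apply: eq_bigr => j _.
by rewrite !mxE mulrC.
Qed.

Definition extension_property (R : realType) (m n1 n2 : nat)
    (P : 'M[R]_(m, n1) -> Prop)
    (calA : {linear 'M[R]_(n1, n2) -> 'cV[R]_m}) : Prop :=
  forall (U : 'M[R]_n1) (V : 'M[R]_(n2, n1)),
    unitary_pair U V -> P (restriction_mx calA U V).

(* Main.v *)
Require Import Defs.
From mathcomp Require Import all_boot all_order all_algebra perm lra.
From mathcomp Require Import interval_inference reals polyrcf complex.

(** Why the theorem holds.  Let [Xs] be as good as [X0] and take a singular
    value decomposition [Xs - X0 = U diag(s) V^T], with [s] the vector of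
    singular values of [Xs - X0].  The restriction [A] of the operator to
    [(U, V)] has property [P], and it sends [s] to the image of [Xs - X0] under
    the operator.  Consider the vectors [x0 = - Sigma(X0)] and [xs = x0 + s].
    The residual of [xs] for the data [A x0 + z] equals the residual of [Xs] for
    the data [y], the vector [x0] has l1 norm equal to the nuclear norm of [X0],
    and sorting the absolute values of [x0] gives back [Sigma(X0)].  So the
    vector hypothesis, applied to [x0] and [xs], is exactly the bound wanted
    for [xs - x0 = s], provided that [xs] is as good as [x0], i.e.
      [sum_i |s_i - sigma_i(X0)| <= nuclear_norm Xs].
    The minus sign in [x0] makes this an instance of Mirsky's inequality
    [sum_i |sigma_i(A) - sigma_i(B)| <= nuclear_norm (A - B)], with
    [A = Xs - X0] and [B = - X0].  The null space statement needs only the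
    decomposition of [W], as the restriction of the operator to [(U, V)] kills
    [Sigma(W)].

    Two ingredients have to be built.

    The singular value decomposition ([singular_value_decomposition]) comes from
    the spectral theorem for real symmetric matrices, proved by deflation: a
    complex eigenvector of a real symmetric matrix yields a real one, which is
    completed to an orthonormal basis ([orthonormal_completion]).  The same
    completion supplies the right singular vectors of zero singular values.
    As singular values are defined through roots of a characteristic polynomial,
    the diagonal obtained must also be identified with the sorted list of
    eigenvalues ([perm_eigenvalues], [spectral_eigenvalues]).

    Mirsky's inequality ([mirsky_nuclear]) is proved through the symmetric
    dilation [dil(A)] with blocks [0, A, A^T, 0], whose eigenvalues are plus and
    minus the singular values of [A], and zeros.  If [A - B = U S V^T] then
    [dil(A - B)] is the difference of the positive semidefinite matrices
    [(1/2) [U; V] S [U; V]^T] and [(1/2) [U; -V] S [U; -V]^T].  Hence [M], the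
    sum of [dil(B)] and the first one, dominates both [dil(A)] and [dil(B)], and
    its trace is the nuclear norm of [A - B].  By Courant-Fischer, the [j]-th
    largest eigenvalue of [M] is at least [max(sigma_j(A), sigma_j(B))], the
    [j]-th smallest is at least [- min(sigma_j(A), sigma_j(B))], and the
    remaining ones are nonnegative.  Summing, the trace of [M] is at least
    [sum_j |sigma_j(A) - sigma_j(B)|] ([dominating_trace]). *)

Import Order.TTheory GRing.Theory Num.Theory.

Local Open Scope ring_scope.

Set Implicit Arguments.
Unset Strict Implicit.
Unset Printing Implicit Defensive.

(** * Row vectors and orthonormal completion *)

Lemma mul_row_tr (R : realType) (p : nat) (x y : 'rV[R]_p) :
  (x *m y^T) 0 0 = \sum_k x 0 k * y 0 k.
Proof. by rewrite mxE; apply: eq_bigr => k _; rewrite mxE. Qed.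

Lemma sqnorm_ge0 (R : realType) (p : nat) (x : 'rV[R]_p) :
  0 <= (x *m x^T) 0 0.
Proof. by rewrite mul_row_tr sumr_ge0 // => k _; rewrite -expr2 sqr_ge0. Qed.

Lemma sqnorm_eq0 (R : realType) (p : nat) (x : 'rV[R]_p) :
  ((x *m x^T) 0 0 == 0) = (x == 0).
Proof.
apply/idP/eqP => [|->]; last by rewrite mul0mx mxE.
rewrite mul_row_tr psumr_eq0 => [/allP x0|k _]; last by rewrite -expr2 sqr_ge0.
apply/rowP => k; rewrite mxE; apply/eqP.
by have := x0 k (mem_index_enum k); rewrite -expr2 sqrf_eq0.
Qed.

Lemma sqnorm_gt0 (R : realType) (p : nat) (x : 'rV[R]_p) :
  (0 < (x *m x^T) 0 0) = (x != 0).
Proof. by rewrite lt0r sqnorm_ge0 sqnorm_eq0 andbT. Qed.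

Lemma normalize_row (R : realType) (p : nat) (x : 'rV[R]_p) : x != 0 ->
  exists2 c : R, c != 0 & (c *: x) *m (c *: x)^T = 1%:M.
Proof.
rewrite -sqnorm_gt0; set s := (x *m x^T) 0 0 => s_gt0.
have r_gt0 : 0 < Num.sqrt s by rewrite sqrtr_gt0.
exists (Num.sqrt s)^-1; first by rewrite invr_eq0 gt_eqF.
rewrite linearZ /= -scalemxAl -scalemxAr scalerA (mx11_scalar (x *m x^T)) -/s.
rewrite -invfM -expr2 sqr_sqrtr ?ltW // scale_scalar_mx mulVf //.
by rewrite gt_eqF.
Qed.

(** A matrix whose rows are orthonormal or zero can have its zero rows filled in
    as long as there are no more rows than columns: while a row is zero the rank
    is less than [p], so some unit vector is orthogonal to all the rows, and it
    can replace that zero row.  [b] marks the rows that are already there. *)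
Lemma orthonormal_completion (R : realType) (n p : nat) (b : pred 'I_n)
    (Y : 'M[R]_(n, p)) :
  (n <= p)%N -> Y *m Y^T = diag_mx (\row_i (b i)%:R) ->
  exists2 Z : 'M[R]_(n, p), Z *m Z^T = 1%:M &
    forall i, b i -> row i Z = row i Y.
Proof.
move=> le_np.
have [k] := ubnP #|[pred i | ~~ b i]|; elim: k => // k IHk in b Y *.
move=> le_k YY; case: (pickP [pred i | ~~ b i]) => [i /= nbi|b1]; last first.
  exists Y => //; rewrite YY -diag_const_mx; congr diag_mx.
  by apply/rowP => i; rewrite !mxE (negbFE (b1 i)).
have Yi0 : row i Y = 0.
  apply/eqP; rewrite -sqnorm_eq0 mul_row_tr.
  have := congr1 (fun M : 'M_n => M i i) YY.
  rewrite /= !mxE eqxx (negbTE nbi) mul0rn => YYi.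
  by apply/eqP; rewrite -[RHS]YYi; apply: eq_bigr => j _; rewrite !mxE.
have rkY : (\rank Y < n)%N.
  rewrite ltn_neqAle rank_leq_row andbT; apply/negP => rfY.
  have: delta_mx 0 i = 0 :> 'rV[R]_n.
    by apply: (row_free_inj rfY); rewrite -rowE Yi0 mul0mx.
  by move/rowP/(_ i); rewrite !mxE !eqxx; apply/eqP; rewrite oner_eq0.
have /rowV0Pn[x /sub_kermxP xY x0] : kermx Y^T != 0.
  by rewrite -mxrank_eq0 mxrank_ker mxrank_tr -lt0n subn_gt0 (leq_trans rkY).
(* A unit vector [u] orthogonal to all rows takes the place of the row [i]. *)
have [c c0 xx] := normalize_row x0.
set u := c *: x in xx.
have uY : u *m Y^T = 0 by rewrite -scalemxAl xY scaler0.
have Yu : Y *m u^T = 0 by apply: trmx_inj; rewrite trmx_mul trmxK uY trmx0.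
pose b' j := (j == i) || b j.
have [||Z ZZ Zb] := IHk b' (Y + delta_mx i 0 *m u).
- rewrite -ltnS; apply: leq_trans le_k; rewrite ltnS.
  apply: proper_card; apply/properP; split.
    by apply/subsetP => j; rewrite !inE negb_or => /andP[].
  by exists i; rewrite !inE ?negbK /b' ?eqxx.
- rewrite linearD /= mulmxDl !mulmxDr trmx_mul trmx_delta YY.
  rewrite !mulmxA Yu mul0mx addr0 -mulmxA uY mulmx0 add0r.
  rewrite -!mulmxA (mulmxA u) xx mul1mx mul_delta_mx.
  apply/matrixP => j l; rewrite !mxE /b'.
  case: (eqVneq j l) => [<-|njl]; first rewrite andbb !mulr1n.
    by case: eqP => [->|]; rewrite ?(negbTE nbi) ?add0r ?addr0.
  rewrite !mulr0n add0r; case: (eqVneq j i) njl => [->|] //= njl.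
  by rewrite eq_sym (negbTE njl).
exists Z => // j bj; rewrite Zb /b' ?bj ?orbT // linearD /= row_mul.
rewrite (_ : row j (delta_mx i 0) = 0) ?mul0mx ?addr0 //.
apply/rowP => l; rewrite !mxE; case: (eqVneq j i) => //= ji.
by rewrite -ji bj in nbi.
Qed.

(** * The spectral theorem for real symmetric matrices *)

(** Over the complex numbers there is an eigenvector [x + i y], with eigenvalue
    [a + i b].  Comparing [x S y^T] with [y S x^T], equal by symmetry, gives
    [b (|x|^2 + |y|^2) = 0], so [b = 0] and both [x] and [y] satisfy the
    eigenvector equation for [a]; at least one of them is nonzero. *)
Lemma symmetric_eigenvector (R : realType) (n : nat) (S : 'M[R]_n.+1) :
  S^T = S -> exists (a : R) (x : 'rV[R]_n.+1), x *m x^T = 1%:M /\ x *m S = a *: x.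
Proof.
move=> symS; suff [a [x x0 xS]] : exists a, exists2 x : 'rV[R]_n.+1, x != 0 &
    x *m S = a *: x.
  have [c c0 xx] := normalize_row x0; exists a, (c *: x); split => //.
  by rewrite -scalemxAl xS !scalerA mulrC.
pose SC := map_mx (real_complex R) S.
have [z] : exists z, root (char_poly SC) z.
  by apply/closed_rootP; rewrite size_char_poly.
rewrite -eigenvalue_root_char => /eigenvalueP[w wS w0].
pose x := map_mx (@complex.Re R) w; pose y := map_mx (@complex.Im R) w.
pose a := complex.Re z; pose b := complex.Im z.
have coordE j : (w *m SC) 0 j =
    real_complex R ((x *m S) 0 j) + 'i%C * real_complex R ((y *m S) 0 j).
  rewrite !mxE !rmorph_sum mulr_sumr -big_split /=.
  apply: eq_bigr => k _; rewrite !mxE !rmorphM mulrA -mulrDl.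
  by congr (_ * _); exact: complexE.
have xS : x *m S = a *: x - b *: y.
  apply/rowP => j; have := coordE j; rewrite wS => /(congr1 (@complex.Re R)).
  rewrite !mxE /a /b; case: (w 0 j) => wr wi; case: (z) => zr zi /=.
  by rewrite !mul0r !mulr0 !subr0 !addr0 => ->.
have yS : y *m S = b *: x + a *: y.
  apply/rowP => j; have := coordE j; rewrite wS => /(congr1 (@complex.Im R)).
  rewrite !mxE /a /b; case: (w 0 j) => wr wi; case: (z) => zr zi /=.
  by rewrite !mul0r !mul1r !add0r addrC => ->.
have b0 : b = 0.
  have : (x *m S *m y^T) 0 0 = (y *m S *m x^T) 0 0.
    have <- : (x *m S *m y^T)^T = y *m S *m x^T.
      by rewrite !trmx_mul trmxK symS mulmxA.
    by rewrite [RHS]mxE.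
  rewrite xS yS mulmxBl mulmxDl -!scalemxAl.
  have ZE c (N : 'M[R]_1) : (c *: N) 0 0 = c * N 0 0 by rewrite mxE.
  rewrite [LHS]mxE [X in _ + X]mxE [RHS]mxE !ZE.
  have -> : (y *m x^T) 0 0 = (x *m y^T) 0 0.
    by rewrite !mul_row_tr; apply: eq_bigr => k _; rewrite mulrC.
  rewrite addrC => /addIr /eqP; rewrite eq_sym -subr_eq0 opprK -mulrDr mulf_eq0.
  case/orP=> [/eqP //|]; rewrite paddr_eq0 ?sqnorm_ge0 // !sqnorm_eq0.
  case/andP => /eqP xe /eqP ye; case/eqP: w0; apply/rowP => j.
  have /rowP/(_ j) := xe; have /rowP/(_ j) := ye; rewrite !mxE.
  by case: (w 0 j) => wr wi /= -> ->.
case: (eqVneq x 0) => [xe|]; last by exists a, x; rewrite // xS b0 scale0r subr0.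
exists a, y; last by rewrite yS b0 scale0r add0r.
apply/eqP => ye; case/eqP: w0; apply/rowP => j.
have /rowP/(_ j) := xe; have /rowP/(_ j) := ye; rewrite !mxE.
by case: (w 0 j) => wr wi /= -> ->.
Qed.

(** Deflation: in an orthonormal basis that starts with an eigenvector, [S] is
    block diagonal with a symmetric lower block of size [n]. *)
Lemma spectral_symmetric (R : realType) (n : nat) (S : 'M[R]_n) :
  S^T = S -> exists (Q : 'M[R]_n) (d : 'rV[R]_n),
    Q *m Q^T = 1%:M /\ S = Q^T *m diag_mx d *m Q.
Proof.
elim: n => [|n IHn] in S *.
  by move=> _; exists 1%:M, 0; split; apply/matrixP => [[]].
move=> symS; have [a [u [uu uS]]] := symmetric_eigenvector symS.
have [||Q QQ Qu] := @orthonormal_completion R n.+1 n.+1 (pred1 0) (delta_mx 0 0 *m u).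
- by [].
- rewrite trmx_mul trmx_delta mulmxA -(mulmxA _ u) uu mulmx1 mul_delta_mx.
  apply/matrixP => i j; rewrite !mxE /=.
  case: (eqVneq i j) => [->|]; first by rewrite andbb mulr1n.
  rewrite mulr0n; case: (eqVneq i 0) => [->|] //= nj0.
  by rewrite eq_sym (negbTE nj0).
have {}Qu : row 0 Q = u.
  by rewrite Qu ?eqxx // row_mul rowE mul_delta_mx -rowE row_id.
have Q'Q := mulmx1C QQ.
pose T : 'M[R]_(1 + n) := Q *m S *m Q^T.
have symT : T^T = T by rewrite /T !trmx_mul trmxK symS mulmxA.
have T0 : row 0 T = a *: delta_mx 0 0.
  rewrite /T !row_mul Qu uS -scalemxAl -Qu -row_mul QQ; congr (_ *: _).
  by apply/rowP => j; rewrite !mxE eqxx eq_sym.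
have SE : S = Q^T *m T *m Q.
  by rewrite /T -!mulmxA Q'Q mulmx1 mulmxA Q'Q mul1mx.
clearbody T; have TE : T = block_mx a%:M 0 0 (drsubmx T).
  rewrite -{1}[T]submxK.
  have ur0 : ursubmx T = 0.
    apply/matrixP => i j; rewrite !mxE !ord1.
    have /rowP/(_ (rshift 1 j)) := T0; rewrite !mxE eqxx /= mulr0 => <-.
    by congr (T _ _); apply: val_inj.
  congr block_mx => //.
    apply/matrixP => i j; rewrite !mxE !ord1.
    have /rowP/(_ 0) := T0; rewrite !mxE !eqxx /= mulr1 => <-.
    by congr (T _ _); apply: val_inj.
  by rewrite -[dlsubmx T]trmxK trmx_dlsub symT ur0 trmx0.
have [|P [d [PP dE]]] := IHn (drsubmx T).
  by rewrite trmx_drsub symT.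
pose F : 'M[R]_(1 + n) := block_mx 1%:M 0 0 P.
have FF : F *m F^T = 1%:M.
  rewrite tr_block_mx !trmx0 trmx1 mulmx_block !mulmx0 !mul0mx !addr0 add0r.
  by rewrite mulmx1 PP -scalar_mx_block.
have FdF : F^T *m diag_mx (row_mx a%:M d) *m F = T.
  rewrite TE tr_block_mx !trmx0 trmx1 diag_mx_row !mulmx_block.
  rewrite !mulmx0 !mul0mx !addr0 !add0r !mulmx1 !mul1mx -dE.
  by congr block_mx; [apply/matrixP => i j; rewrite !ord1 !mxE|rewrite mul0mx].
clearbody F; exists (F *m (Q : 'M_(1 + n))), (row_mx a%:M d); split.
  by rewrite trmx_mul mulmxA -(mulmxA F) QQ mulmx1 FF.
by rewrite SE -FdF trmx_mul !mulmxA.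
Qed.

(** * Eigenvalues with multiplicity, in decreasing order *)

Lemma char_poly_orthogonal_diag (R : realType) (n : nat) (Q : 'M[R]_n)
    (d : 'rV[R]_n) : Q *m Q^T = 1%:M ->
  char_poly (Q^T *m diag_mx d *m Q) = \prod_(i < n) ('X - (d 0 i)%:P).
Proof.
move=> QQ; have Q'Q := mulmx1C QQ.
transitivity (char_poly (diag_mx d)); last first.
  rewrite char_poly_trig; first by apply: eq_bigr => i _; rewrite mxE eqxx.
  by apply/is_trig_mxP => i j ij; rewrite mxE eqE /= ltn_eqF.
rewrite /char_poly.
have -> : char_poly_mx (Q^T *m diag_mx d *m Q) =
    map_mx polyC Q^T *m char_poly_mx (diag_mx d) *m map_mx polyC Q.
  rewrite /char_poly_mx mulmxBr mulmxBl !map_mxM; congr (_ - _).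
  by rewrite mul_mx_scalar -scalemxAl -map_mxM Q'Q map_scalar_mx scalemx1.
rewrite !det_mulmx mulrAC -det_mulmx -map_mxM Q'Q map_scalar_mx det1 ?mul1r //.
Qed.

(** Both lists contain each real number as often as its multiplicity as a root
    of the characteristic polynomial, which splits by orthogonal
    diagonalization. *)
Lemma perm_eigenvalues (R : realType) (n : nat) (Q : 'M[R]_n) (d : 'rV[R]_n) :
  Q *m Q^T = 1%:M ->
  perm_eq (eigenvalues (Q^T *m diag_mx d *m Q)) [seq d 0 i | i <- enum 'I_n].
Proof.
move=> QQ; rewrite /eigenvalues (char_poly_orthogonal_diag _ QQ).
rewrite (_ : \prod_(i < n) _ =
    \prod_(y <- [seq d 0 i | i <- enum 'I_n]) ('X - y%:P)); last first.
  by rewrite big_map big_enum.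
set s := [seq d 0 i | i <- enum 'I_n]; set p := \prod_(y <- s) ('X - y%:P).
rewrite perm_sort; apply/allP => x _ /=; apply/eqP.
rewrite count_flatten -map_comp sumnE big_map /=.
under eq_bigr => a _ do rewrite mu_prod_XsubC count_nseq /=.
have p0 : p != 0 by rewrite monic_neq0 // monic_prod_XsubC.
have xs : (x \in rootsR p) = (x \in s).
  have /(_ x) := roots_onP (roots_on_rootsR p0).
  by rewrite in_itv /= => /(_ isT) <-; rewrite root_prod_XsubC.
case: (boolP (x \in s)) => sx; last first.
  rewrite (count_memPn sx) big1_seq // => a /andP[_ ra].
  by case: eqP => // ax; case/negP: sx; rewrite -xs -ax.
rewrite -xs in sx; rewrite (bigD1_seq x) ?uniq_roots //= eqxx mul1n big1 ?addn0 // => a.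
by move=> /negbTE ->.
Qed.

Lemma size_eigenvalues (R : realType) (n : nat) (S : 'M[R]_n) :
  S^T = S -> size (eigenvalues S) = n.
Proof.
move=> /spectral_symmetric[Q [d [QQ ->]]].
by rewrite (perm_size (perm_eigenvalues d QQ)) size_map size_enum_ord.
Qed.

Lemma eigenvalues_nonincreasing (R : realType) (n : nat) (S : 'M[R]_n)
    (i j : nat) : (i <= j < size (eigenvalues S))%N ->
  nth 0 (eigenvalues S) j <= nth 0 (eigenvalues S) i.
Proof.
move=> /andP[le_ij lt_j].
have srt : sorted >=%R (eigenvalues S) by apply: sort_sorted; exact: ge_total.
by apply: (sorted_leq_nth ge_trans lexx 0 srt); rewrite // inE (leq_ltn_trans le_ij).
Qed.

(** The order of the diagonal in a spectral decomposition is arbitrary: permuting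
    the eigenvectors puts it in the order chosen by [eigenvalues]. *)
Lemma spectral_eigenvalues (R : realType) (n : nat) (S : 'M[R]_n) : S^T = S ->
  exists2 Q : 'M[R]_n, Q *m Q^T = 1%:M &
    S = Q^T *m diag_mx (\row_i nth 0 (eigenvalues S) i) *m Q.
Proof.
move=> symS; have [Q [d [QQ SE]]] := spectral_symmetric symS.
have := perm_eigenvalues d QQ; rewrite -SE.
pose t := [tuple d 0 i | i < n].
have -> : [seq d 0 i | i <- enum 'I_n] = t by [].
case/tuple_permP => p eigE.
have dE (i : 'I_n) : nth 0 (eigenvalues S) i = d 0 (p i).
  by rewrite eigE -tnth_nth tnth_mktuple tnth_mktuple.
exists (row_perm p Q).
  rewrite row_permE trmx_mul mulmxA -(mulmxA _ Q) QQ mulmx1 tr_perm_mx -perm_mxM.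
  by rewrite mulgV perm_mx1.
have -> : diag_mx (\row_i nth 0 (eigenvalues S) i) =
    perm_mx p *m diag_mx d *m (perm_mx p)^T.
  rewrite tr_perm_mx -row_permE -col_permE; apply/matrixP => i j; rewrite !mxE.
  by rewrite dE (inj_eq perm_inj).
rewrite row_permE trmx_mul !mulmxA.
have PP : (perm_mx p)^T *m perm_mx p = 1%:M :> 'M[R]_n.
  by rewrite tr_perm_mx -perm_mxM mulVg perm_mx1.
by rewrite -(mulmxA Q^T) PP mulmx1 -(mulmxA _ _^T) PP mulmx1.
Qed.

(** * Singular value decomposition *)

(** The index is a natural number, with value 0 from [n1] on: the eigenvalues of
    the dilation of [X] that are not plus or minus a singular value are zeros,
    and this convention treats them along with the others. *)
Definition singval (R : realType) (n1 n2 : nat) (X : 'M[R]_(n1, n2)) (j : nat) : R :=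
  Num.sqrt (nth 0 (eigenvalues (X *m X^T)) j).

Lemma singular_valuesE (R : realType) (n1 n2 : nat) (X : 'M[R]_(n1, n2)) i :
  singular_values X i 0 = singval X i.
Proof. by rewrite mxE. Qed.

Lemma tr_singular_valuesE (R : realType) (n1 n2 : nat) (X : 'M[R]_(n1, n2)) i :
  (singular_values X)^T 0 i = singval X i.
Proof. by rewrite mxE singular_valuesE. Qed.

Lemma singval_ge0 (R : realType) (n1 n2 : nat) (X : 'M[R]_(n1, n2)) j :
  0 <= singval X j.
Proof. exact: sqrtr_ge0. Qed.

Lemma gram_symmetric (R : realType) (n1 n2 : nat) (X : 'M[R]_(n1, n2)) :
  (X *m X^T)^T = X *m X^T.
Proof. by rewrite trmx_mul trmxK. Qed.

Lemma singval_default (R : realType) (n1 n2 : nat) (X : 'M[R]_(n1, n2)) j :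
  (n1 <= j)%N -> singval X j = 0.
Proof.
move=> le_n1_j; rewrite /singval nth_default ?sqrtr0 //.
by rewrite size_eigenvalues ?gram_symmetric.
Qed.

Lemma singval_nonincreasing (R : realType) (n1 n2 : nat) (X : 'M[R]_(n1, n2))
    (i j : nat) : (i <= j)%N -> singval X j <= singval X i.
Proof.
move=> le_ij; have [le_n1_j|lt_j_n1] := leqP n1 j.
  by rewrite (singval_default X le_n1_j) singval_ge0.
apply: ler_wsqrtr; apply: eigenvalues_nonincreasing.
by rewrite le_ij size_eigenvalues ?gram_symmetric.
Qed.

Lemma row_diag_mul (R : realType) (n p : nat) (d : 'rV[R]_n) (A : 'M[R]_(n, p)) i :
  row i (diag_mx d *m A) = d 0 i *: row i A.
Proof. by rewrite row_mul row_diag_mx -scalemxAl -rowE. Qed.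

(** If [X X^T = Q^T diag(d) Q] then the rows of [Y = Q X] are orthogonal with
    squared norms [d_i].  Dividing each nonzero row by its norm and completing
    gives [V^T]; the zero rows of [Y] get coefficient [sqrt 0 = 0], so that it
    does not matter how they were completed. *)
Lemma singular_value_decomposition (R : realType) (n1 n2 : nat)
    (X : 'M[R]_(n1, n2)) : (n1 <= n2)%N ->
  exists (U : 'M[R]_n1) (V : 'M[R]_(n2, n1)), unitary_pair U V /\
    X = U *m diag_mx (singular_values X)^T *m V^T.
Proof.
move=> le_n.
have [Q QQ XX] := spectral_eigenvalues (gram_symmetric X).
set d := (\row_i _) in XX; have Q'Q := mulmx1C QQ.
pose Y := Q *m X.
have YY : Y *m Y^T = diag_mx d.
  rewrite /Y trmx_mul mulmxA -(mulmxA Q) XX !mulmxA QQ mul1mx -mulmxA QQ.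
  by rewrite mulmx1.
have Yi i : (row i Y *m (row i Y)^T) 0 0 = d 0 i.
  have := congr1 (fun M : 'M_n1 => M i i) YY.
  rewrite /= [in RHS]mxE eqxx mulr1n => <-.
  by rewrite mul_row_tr [RHS]mxE; apply: eq_bigr => k _; rewrite !mxE.
have d_ge0 i : 0 <= d 0 i by rewrite -Yi sqnorm_ge0.
have dE i : Num.sqrt (d 0 i) = singular_values X i 0.
  by rewrite singular_valuesE mxE.
(* Where [d_i = 0] the inverse is 0 too, so [diag(c) Y] keeps a zero row. *)
clearbody d; pose c : 'rV[R]_n1 := \row_i (Num.sqrt (d 0 i))^-1.
have [|Z ZZ Zb] := @orthonormal_completion R n1 n2
  (fun i => d 0 i != 0) (diag_mx c *m Y) le_n.
  rewrite trmx_mul tr_diag_mx mulmxA -(mulmxA _ Y) YY !mulmx_diag.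
  congr diag_mx; apply/rowP => i; rewrite [LHS]mxE [X in X * _]mxE mulrAC !mxE.
  have [->|di0] := eqVneq (d 0 i) 0; first by rewrite mulr0.
  have sd0 : Num.sqrt (d 0 i) != 0.
    by rewrite gt_eqF // sqrtr_gt0 lt0r di0 d_ge0.
  by rewrite -invfM -expr2 sqr_sqrtr // mulVf.
exists Q^T, Z^T; rewrite /unitary_pair !trmxK; split=> //.
suff YE : Y = diag_mx (singular_values X)^T *m Z.
  by rewrite -mulmxA -YE mulmxA Q'Q mul1mx.
apply/row_matrixP => i.
rewrite row_diag_mul mxE -dE; have [di0|di0] := eqVneq (d 0 i) 0.
  rewrite di0 sqrtr0 scale0r; apply/eqP.
  by rewrite -sqnorm_eq0 Yi di0.
rewrite Zb // row_diag_mul mxE scalerA mulfV ?scale1r //.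
by rewrite gt_eqF // sqrtr_gt0 lt0r di0 d_ge0.
Qed.

(** * Courant-Fischer bounds *)

Lemma mul_pid_mx_eq0 (R : realType) (n r : nat) (z : 'rV[R]_n) :
  z *m (pid_mx r : 'M_(n, r)) = 0 -> forall j : 'I_n, (j < r)%N -> z 0 j = 0.
Proof.
move=> zr j ltjr; have /rowP/(_ (Ordinal ltjr)) := zr.
rewrite !mxE (bigD1 j) //= !mxE eqxx ltjr mulr1 big1 ?addr0 // => k nkj.
by rewrite mxE /= (_ : (k == j :> nat) = false) ?mulr0 //; exact: negbTE.
Qed.

Lemma diag_form (R : realType) (n : nat) (d x y : 'rV[R]_n) :
  (x *m diag_mx d *m y^T) 0 0 = \sum_i d 0 i * (x 0 i * y 0 i).
Proof.
rewrite mul_row_tr; apply: eq_bigr => i _.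
by rewrite mul_mx_diag mxE mulrCA mulrA.
Qed.

(** If the quadratic form of [M] is at least [c |x|^2] on a subspace of dimension
    more than [i], then that subspace meets the span of the eigenvectors of index
    [i] and beyond, which has codimension [i]; there the form is at most
    [mu_i |x|^2]. *)
Lemma courant_fischer_lower_bound (R : realType) (N k : nat) (M Q : 'M[R]_N)
    (mu : nat -> R) (E : 'M[R]_(k, N)) (c : R) (i : 'I_N) :
  Q *m Q^T = 1%:M -> M = Q^T *m diag_mx (\row_j mu j) *m Q ->
  (forall j l : 'I_N, (j <= l)%N -> mu l <= mu j) ->
  (i < \rank E)%N ->
  (forall x : 'rV[R]_N, (x <= E)%MS ->
    c * (x *m x^T) 0 0 <= (x *m M *m x^T) 0 0) ->
  c <= mu i.
Proof.
move=> QQ ME mu_anti rkE Ec; have Q'Q := mulmx1C QQ.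
(* Row vectors [y] with [y K = 0] are the coordinates, in a basis of [E], of the
   vectors orthogonal to the first [i] eigenvectors. *)
pose K := row_base E *m Q^T *m (pid_mx i : 'M_(N, i)).
have /rowV0Pn[y /sub_kermxP yK y0] : kermx K != 0.
  rewrite -mxrank_eq0 mxrank_ker -lt0n subn_gt0.
  exact: leq_ltn_trans (rank_leq_col _) rkE.
pose x := y *m row_base E; pose z := x *m Q^T.
have x0 : x != 0.
  apply: contra y0 => /eqP xe; apply/eqP.
  by apply: (row_free_inj (row_base_free E)); rewrite mul0mx.
have xE : (x <= E)%MS by rewrite -(eq_row_base E) submxMl.
have z0 (j : 'I_N) : (j < i)%N -> z 0 j = 0.
  by apply: mul_pid_mx_eq0; rewrite /z /x -!mulmxA !mulmxA in yK *.
have zz : z *m z^T = x *m x^T.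
  by rewrite /z trmx_mul trmxK mulmxA -(mulmxA x) Q'Q mulmx1.
have xMx : x *m M *m x^T = z *m diag_mx (\row_j mu j) *m z^T.
  by rewrite ME /z [(x *m Q^T)^T]trmx_mul trmxK !mulmxA.
have := Ec x xE; rewrite xMx diag_form => /le_trans le_c.
rewrite -(@ler_pM2r _ ((x *m x^T) 0 0)) ?sqnorm_gt0 //; apply: le_c.
rewrite -zz mul_row_tr mulr_sumr; apply: ler_sum => j _.
rewrite [X in X * _ <= _]mxE.
have [lt_ji|le_ij] := ltnP j i; first by rewrite z0 // !mulr0.
by rewrite ler_wpM2r ?mu_anti // -expr2 sqr_ge0.
Qed.

(** The defect is the squared norm of the residual [b - b V V^T]. *)
Lemma bessel_inequality (R : realType) (p n : nat) (V : 'M[R]_(p, n)) (b : 'rV[R]_p) :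
  V^T *m V = 1%:M ->
  ((b *m V) *m (b *m V)^T) 0 0 <= (b *m b^T) 0 0.
Proof.
move=> VV; rewrite -subr_ge0.
suff <- : ((b - b *m V *m V^T) *m (b - b *m V *m V^T)^T) 0 0 =
    (b *m b^T) 0 0 - ((b *m V) *m (b *m V)^T) 0 0 by exact: sqnorm_ge0.
have -> : (b - b *m V *m V^T) *m (b - b *m V *m V^T)^T =
    b *m b^T - (b *m V) *m (b *m V)^T.
  rewrite linearB /= !trmx_mul trmxK mulmxBl !mulmxBr !mulmxA.
  by rewrite -(mulmxA _ V^T V) VV mulmx1 subrr subr0.
by rewrite [LHS]mxE [X in _ + X]mxE.
Qed.

(** The expression [2 a A b^T] is the quadratic form of the dilation of [A] at the
    row [(a, b)] (see [dilation_form]).  The rows [(u_k, v_k)] with [k <= j],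
    built from singular vectors, are eigenvectors for [sigma_k >= sigma_j]; they
    span [E]. *)
Lemma dilation_form_top (R : realType) (n p : nat) (A : 'M[R]_(n, p)) (j : nat) :
  (n <= p)%N -> (j < n)%N ->
  exists2 E : 'M[R]_(j.+1, n + p), (j < \rank E)%N &
    forall (a : 'rV[R]_n) (b : 'rV[R]_p), (row_mx a b <= E)%MS ->
      singval A j * ((a *m a^T) 0 0 + (b *m b^T) 0 0) <=
      2 * (a *m A *m b^T) 0 0.
Proof.
move=> le_np lt_jn.
have [U [V [[U'U UU' VV] AE]]] := singular_value_decomposition A le_np.
pose J : 'M[R]_(j.+1, n) := pid_mx j.+1.
exists (J *m row_mx U^T V^T).
  have JJ : J *m J^T = 1%:M.
    by rewrite tr_pid_mx mul_pid_mx minnn (minn_idPr lt_jn) pid_mx_1.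
  apply: leq_trans (mxrankM_maxl _ (J *m row_mx U^T V^T)^T).
  rewrite trmx_mul tr_row_mx !trmxK mulmxA -(mulmxA J) mul_row_col U'U VV.
  by rewrite mulmxDr mulmx1 mulmxDl JJ -mulr2n -scaler_nat mxrank_scale_nz ?mxrank1 //.
move=> a b /submxP[y]; rewrite mulmxA mul_mx_row => /eq_row_mx[-> ->].
set z := y *m J.
have zj (k : 'I_n) : (j < k)%N -> z 0 k = 0.
  move=> lt_jk; rewrite mxE big1 // => l _; rewrite mxE.
  have lt_lk : (l < k)%N by exact: leq_trans (ltn_ord l) lt_jk.
  by rewrite (ltn_eqF lt_lk) mulr0.
have UzE : z *m U^T *m (z *m U^T)^T = z *m z^T.
  by rewrite trmx_mul trmxK mulmxA -(mulmxA z) U'U mulmx1.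
have VzE : z *m V^T *m (z *m V^T)^T = z *m z^T.
  by rewrite trmx_mul trmxK mulmxA -(mulmxA z) VV mulmx1.
have AzE : z *m U^T *m A *m (z *m V^T)^T = z *m diag_mx (singular_values A)^T *m z^T.
  by rewrite {1}AE trmx_mul trmxK !mulmxA -(mulmxA z) U'U mulmx1
    -(mulmxA _ V^T V) VV mulmx1.
rewrite UzE VzE AzE diag_form mul_row_tr -mulr2n mulrnAr mulr_natl ler_wMn2r //.
rewrite mulr_sumr; apply: ler_sum => k _; rewrite tr_singular_valuesE.
have [lt_jk|le_kj] := ltnP j k; first by rewrite zj // !mulr0.
by rewrite ler_wpM2r ?singval_nonincreasing // -expr2 sqr_ge0.
Qed.

(** The rows [(u_k, - v_k)] with [k < j] are eigenvectors of the dilation for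
    [- sigma_k], and [E] is their orthogonal complement, of dimension at least
    [n + p - j].  On it [a.u_k = b.v_k] for [k < j], so these [k] contribute
    nonnegatively to [2 a A b^T], while the others contribute at least
    [- sigma_j ((a.u_k)^2 + (b.v_k)^2)].  For [j >= n] the constraints for all [k]
    are imposed and the bound is 0. *)
Lemma dilation_form_bottom (R : realType) (n p : nat) (A : 'M[R]_(n, p)) (j : nat) :
  (n <= p)%N -> (j < n + p)%N ->
  exists2 E : 'M[R]_(n + p), (n + p - j.+1 < \rank E)%N &
    forall (a : 'rV[R]_n) (b : 'rV[R]_p), (row_mx a b <= E)%MS ->
      - singval A j * ((a *m a^T) 0 0 + (b *m b^T) 0 0) <=
      2 * (a *m A *m b^T) 0 0.
Proof.
move=> le_np lt_jN.
have [U [V [[U'U UU' VV] AE]]] := singular_value_decomposition A le_np.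
pose G := col_mx U (- V) *m (pid_mx j : 'M_(n, j)).
exists (kermx G).
  rewrite mxrank_ker; have := rank_leq_col G; move: (\rank G) => r le_rj.
  by rewrite ltn_sub2lE // ltnS.
move=> a b /sub_kermxP; rewrite mulmxA mul_row_col mulmxN => abG.
pose al := a *m U; pose be := b *m V.
have albe (k : 'I_n) : (k < j)%N -> al 0 k = be 0 k.
  move=> ltkj; apply/eqP; rewrite -subr_eq0; apply/eqP.
  by have := mul_pid_mx_eq0 abG ltkj; rewrite [LHS]mxE [X in _ + X]mxE.
have aa : a *m a^T = al *m al^T.
  by rewrite /al trmx_mul mulmxA -(mulmxA a) UU' mulmx1.
have AE2 : a *m A *m b^T = al *m diag_mx (singular_values A)^T *m be^T.
  by rewrite {1}AE /al /be trmx_mul !mulmxA.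
have bb := bessel_inequality b VV; rewrite -/be in bb.
rewrite aa AE2 diag_form.
apply: (@le_trans _ _ (- singval A j * ((al *m al^T) 0 0 + (be *m be^T) 0 0))).
  by rewrite !mulNr lerN2 ler_wpM2l ?singval_ge0 // lerD2l.
rewrite !mul_row_tr -big_split /= !mulr_sumr; apply: ler_sum => k _.
rewrite tr_singular_valuesE.
have sj0 := singval_ge0 A j; have sk0 := singval_ge0 A k.
have [lt_kj|le_jk] := ltnP k j.
  rewrite albe //; have := sqr_ge0 (be 0 k); nra.
have := singval_nonincreasing A le_jk.
have := sqr_ge0 (al 0 k + be 0 k); have := sqr_ge0 (al 0 k); have := sqr_ge0 (be 0 k).
nra.
Qed.

(** * Mirsky's inequality for the nuclear norm *)

Definition dilation (R : realType) (n p : nat) (A : 'M[R]_(n, p)) : 'M[R]_(n + p) :=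
  block_mx 0 A A^T 0.

Lemma dilation_form (R : realType) (n p : nat) (A : 'M[R]_(n, p))
    (a : 'rV[R]_n) (b : 'rV[R]_p) :
  (row_mx a b *m dilation A *m (row_mx a b)^T) 0 0 = 2 * (a *m A *m b^T) 0 0.
Proof.
rewrite /dilation mul_row_block !mulmx0 add0r addr0 tr_row_mx mul_row_col mxE.
have -> : b *m A^T *m a^T = (a *m A *m b^T)^T by rewrite !trmx_mul trmxK mulmxA.
by rewrite [X in X + _]mxE -mulr2n mulr_natl.
Qed.

Lemma row_sqnorm (R : realType) (n p : nat) (a : 'rV[R]_n) (b : 'rV[R]_p) :
  (row_mx a b *m (row_mx a b)^T) 0 0 = (a *m a^T) 0 0 + (b *m b^T) 0 0.
Proof. by rewrite tr_row_mx mul_row_col mxE. Qed.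

(** The eigenvalues of [M] are summed in pairs, the [j]-th largest with the [j]-th
    smallest.  As the largest is at least each of [sigma_j(A)], [sigma_j(B)] and
    the smallest at least each of [- sigma_j(A)], [- sigma_j(B)], the sum of the
    pair is at least [|sigma_j(A) - sigma_j(B)|]; the [p - n] unpaired
    eigenvalues in the middle are nonnegative. *)
Lemma dominating_trace (R : realType) (n p : nat) (A B : 'M[R]_(n, p))
    (M : 'M[R]_(n + p)) :
  (n <= p)%N -> M^T = M ->
  (forall C, C = A \/ C = B -> forall x : 'rV[R]_(n + p),
     (x *m dilation C *m x^T) 0 0 <= (x *m M *m x^T) 0 0) ->
  \sum_(j < n) `|singval A j - singval B j| <= \tr M.
Proof.
move=> le_np symM leM; have [Q QQ ME] := spectral_eigenvalues symM.
pose mu j := nth 0 (eigenvalues M) j.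
have mu_anti (j l : 'I_(n + p)) : (j <= l)%N -> mu l <= mu j.
  move=> le_jl; apply: eigenvalues_nonincreasing.
  by rewrite le_jl size_eigenvalues ?ltn_ord.
have top C (j : 'I_n) : C = A \/ C = B -> singval C j <= mu j.
  move=> CAB; have [E rkE Eform] := dilation_form_top C le_np (ltn_ord j).
  apply: (courant_fischer_lower_bound (i := lshift p j) (E := E) QQ ME mu_anti)
    => // x xE.
  apply: le_trans (leM C CAB x); move: xE; rewrite -[x]hsubmxK => xE.
  by rewrite row_sqnorm dilation_form Eform.
have bot C j : C = A \/ C = B -> (j < n + p)%N ->
    - singval C j <= mu (n + p - j.+1)%N.
  move=> CAB ltj; have [E rkE Eform] := dilation_form_bottom C le_np ltj.
  have lti : (n + p - j.+1 < n + p)%N by rewrite ltn_subrL (leq_trans _ ltj).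
  apply: (courant_fischer_lower_bound (i := Ordinal lti) (E := E) QQ ME mu_anti)
    => // x xE.
  apply: le_trans (leM C CAB x); move: xE; rewrite -[x]hsubmxK => xE.
  by rewrite row_sqnorm dilation_form Eform.
have -> : \tr M = \sum_(j < n + p) mu j.
  rewrite {1}ME mxtrace_mulC mulmxA QQ mul1mx mxtrace_diag.
  by apply: eq_bigr => j _; rewrite mxE.
rewrite big_split_ord /= [X in _ + X](reindex_inj rev_ord_inj) /=.
have revE (j : nat) : (j < p)%N -> (n + (p - j.+1) = n + p - j.+1)%N.
  by move=> ltj; rewrite addnBA.
apply: (@le_trans _ _ (\sum_(j < n) (mu j + mu (n + p - j.+1)%N))).
  apply: ler_sum => j _.
  have ltj : (j < n + p)%N by rewrite (leq_trans (ltn_ord j)) ?leq_addr.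
  have := top A j (or_introl erefl); have := top B j (or_intror erefl).
  have := bot A j (or_introl erefl) ltj; have := bot B j (or_intror erefl) ltj.
  move=> b1 b2 t1 t2; rewrite ler_norml; apply/andP; split; lra.
rewrite big_split lerD2l /=.
rewrite (big_ord_widen p (fun j => mu (n + p - j.+1)%N) le_np) big_mkcond /=.
apply: ler_sum => j _; rewrite revE //; case: ltnP => // le_nj.
have ltj : (j < n + p)%N by rewrite (leq_trans (ltn_ord j)) ?leq_addl.
by have := bot A j (or_introl erefl) ltj; rewrite singval_default // oppr0.
Qed.

(** The dominating matrix is [dilation B + P], where [P] is the positive part of
    the dilation of [A - B] read off from its singular value decomposition.  That
    it dominates [dilation A] is, for each singular value, the inequality
    [2 x y <= (x + y)^2 / 2]. *)
Lemma mirsky_nuclear (R : realType) (n p : nat) (A B : 'M[R]_(n, p)) :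
  (n <= p)%N ->
  \sum_(j < n) `|singval A j - singval B j| <= nuclear_norm (A - B).
Proof.
move=> le_np.
have [U [V [[U'U UU' VV] DE]]] := singular_value_decomposition (A - B) le_np.
set s := (singular_values (A - B))^T in DE.
pose W := col_mx U V; pose P := 2^-1 *: (W *m diag_mx s *m W^T).
have trM : \tr (dilation B + P) = nuclear_norm (A - B).
  rewrite linearD /= mxtrace_block !mxtrace0 addr0 add0r /P linearZ /=.
  rewrite mxtrace_mulC mulmxA /W tr_col_mx mul_row_col U'U VV.
  rewrite mulmxDl mul1mx linearD /= mxtrace_diag.
  have -> : \sum_j s 0 j = nuclear_norm (A - B).
    by apply: eq_bigr => j _; rewrite mxE.
  by rewrite -mulr2n -[X in _ * X]mulr_natl mulrA mulVf ?mul1r ?pnatr_eq0.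
rewrite -trM; apply: dominating_trace => //.
  rewrite linearD /= tr_block_mx trmxK !trmx0 /P linearZ /=.
  by rewrite !trmx_mul trmxK tr_diag_mx mulmxA.
have Pform (a : 'rV[R]_n) (b : 'rV[R]_p) : (row_mx a b *m P *m (row_mx a b)^T) 0 0 =
    2^-1 * \sum_k s 0 k * ((a *m U) 0 k + (b *m V) 0 k) ^+ 2.
  rewrite /P -scalemxAr -scalemxAl mxE; congr (_ * _).
  have -> : row_mx a b *m (W *m diag_mx s *m W^T) *m (row_mx a b)^T =
      (row_mx a b *m W) *m diag_mx s *m (row_mx a b *m W)^T.
    by rewrite trmx_mul !mulmxA.
  rewrite diag_form; apply: eq_bigr => k _.
  by rewrite mul_row_col -expr2 [X in X ^+ 2]mxE.
have Dform (a : 'rV[R]_n) (b : 'rV[R]_p) : (a *m (A - B) *m b^T) 0 0 =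
    \sum_k s 0 k * ((a *m U) 0 k * (b *m V) 0 k).
  rewrite -diag_form DE; congr (fun_of_matrix _ 0 0).
  by rewrite trmx_mul !mulmxA.
have s_ge0 k : 0 <= s 0 k by rewrite tr_singular_valuesE singval_ge0.
move=> C CAB x; rewrite -[x]hsubmxK; move: (lsubmx x) (rsubmx x) => a b.
rewrite mulmxDr mulmxDl [X in _ <= X]mxE !dilation_form Pform.
case: CAB => ->; last first.
  rewrite lerDl mulr_ge0 ?invr_ge0 ?ler0n // sumr_ge0 // => k _.
  by rewrite mulr_ge0 ?sqr_ge0.
have -> : a *m A *m b^T = a *m B *m b^T + a *m (A - B) *m b^T.
  by rewrite -mulmxDl -mulmxDr addrC subrK.
rewrite [X in 2 * X]mxE mulrDr lerD2l Dform !mulr_sumr; apply: ler_sum => k _.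
have := s_ge0 k; have := sqr_ge0 ((a *m U) 0 k - (b *m V) 0 k); nra.
Qed.

(** * Transfer from vectors to matrices *)

Lemma singvalN (R : realType) (n1 n2 : nat) (X : 'M[R]_(n1, n2)) j :
  singval (- X) j = singval X j.
Proof. by rewrite /singval linearN /= mulmxN mulNmx opprK. Qed.

Lemma sort_abs_oppr_singular_values (R : realType) (n1 n2 : nat)
    (X : 'M[R]_(n1, n2)) :
  sort_abs (- singular_values X) = singular_values X.
Proof.
apply/colP => i; rewrite mxE singular_valuesE.
have -> : [seq `|(- singular_values X) j 0| | j <- enum 'I_n1] =
    map (singval X) (iota 0 n1).
  rewrite -val_enum_ord -map_comp; apply: eq_map => j /=.
  by rewrite mxE singular_valuesE normrN ger0_norm ?singval_ge0.
rewrite sorted_sort; first by rewrite (nth_map 0) ?size_iota // nth_iota.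
  exact: ge_trans.
apply: (homo_sorted (e := leq)) (iota_sorted 0 n1).
exact: singval_nonincreasing.
Qed.

Lemma restriction_svd (R : realType) (m n1 n2 : nat)
    (calA : {linear 'M[R]_(n1, n2) -> 'cV[R]_m}) (W : 'M[R]_(n1, n2)) :
  (n1 <= n2)%N ->
  exists (U : 'M[R]_n1) (V : 'M[R]_(n2, n1)), unitary_pair U V /\
    restriction_mx calA U V *m singular_values W = calA W.
Proof.
move=> le_n; have [U [V [UV WE]]] := singular_value_decomposition W le_n.
by exists U, V; split=> //; rewrite restriction_mxE /restriction -WE.
Qed.

Unset Implicit Arguments.

Theorem theorem1 (R : realType) (m n n2 : nat)
    (m_gt0 : (0 < m)%N) (n_gt0 : (0 < n)%N) (le_n_n2 : (n <= n2)%N)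
    (eps : {nonneg R})
    (P : 'M[R]_(m, n) -> Prop) (Q : 'cV[R]_n -> Prop)
    (v : 'cV[R]_n -> R) (v_norm : is_norm v)
    (v_sort_abs : forall x : 'cV[R]_n, v x = v (sort_abs x))
    (h : 'cV[R]_n -> {nonneg R} -> R) :
  ((forall A : 'M[R]_(m, n), P A ->
      forall (x0 : 'cV[R]_n) (z : 'cV[R]_m), l2norm z <= eps%:num ->
      forall (y : 'cV[R]_m), y = A *m x0 + z ->
      forall xs : 'cV[R]_n, as_good_vec A y eps%:num xs x0 ->
        v (xs - x0) <= h (sort_abs x0) eps) ->
   forall calA : {linear 'M[R]_(n, n2) -> 'cV[R]_m},
     extension_property P calA ->
     forall (X0 : 'M[R]_(n, n2)) (z : 'cV[R]_m), l2norm z <= eps%:num ->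
     forall (y : 'cV[R]_m), y = calA X0 + z ->
     forall Xs : 'M[R]_(n, n2), as_good_mx calA y eps%:num Xs X0 ->
       induced_mnorm v (Xs - X0) <= h (singular_values X0) eps)
  /\
  ((forall A : 'M[R]_(m, n), P A ->
      forall w : 'cV[R]_n, A *m w = 0 -> Q w) ->
   forall calA : {linear 'M[R]_(n, n2) -> 'cV[R]_m},
     extension_property P calA ->
     forall W : 'M[R]_(n, n2), calA W = 0 -> Q (singular_values W)).
Proof.
split=> [vecP calA Pe X0 z z_eps y yE Xs [Xs_eps Xs_le] | vecP calA Pe W W0].
  have [U [V [UV AW]]] := restriction_svd calA (Xs - X0) le_n_n2.
  set A := restriction_mx calA U V in AW.
  (* The sign turns the l1 norm of [xs] into a sum of differences of singular
     values, which Mirsky's inequality bounds. *)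
  pose x0 := - singular_values X0.
  pose xs := x0 + singular_values (Xs - X0).
  have xsE : xs - x0 = singular_values (Xs - X0) by rewrite addrAC subrr add0r.
  rewrite /induced_mnorm -xsE -(sort_abs_oppr_singular_values X0).
  apply: (vecP A (Pe U V UV) x0 z z_eps (A *m x0 + z)) => //; split.
    rewrite (_ : A *m xs - _ = calA Xs - y) //.
    by rewrite opprD addrA -mulmxBr xsE AW yE linearB opprD addrA.
  have <- : nuclear_norm X0 = l1norm x0.
    apply: eq_bigr => j _.
    by rewrite [x0 j 0]mxE normrN singular_valuesE ger0_norm ?singval_ge0.
  apply: le_trans Xs_le.
  have := mirsky_nuclear (Xs - X0) (- X0) le_n_n2; rewrite opprK subrK.
  apply: le_trans; apply: ler_sum => j _.
  by rewrite singvalN !mxE addrC.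
have [U [V [UV AW]]] := restriction_svd calA W le_n_n2.
by apply: (vecP _ (Pe U V UV)); rewrite AW.
Qed.
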